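(* Let $n \geq 2$ be any integer. (i) The identities \[ x^{n+1} \approx x^n, \qquad x^{m_1}y^{m_2} \approx y^{m_2}x^{m_1}\ \ (m_1,m_2 \in\{2,3,4,\ldots\}), \qquad xya \approx yxa \] constitute an identity basis for the variety $\operatorname{var}\{J,N_n^1\}$ of semigroups. (ii) The identities \[ x^{n+1} \approx x^n, \qquad x^2y^2 \approx y^2x^2, \qquad xya \approx yxa \] also constitute an identity basis for the variety $\operatorname{var}\{J,N_n^1\}$. (iii) The variety $\operatorname{var}\{J,N_n^1\}$ contains countably infinitely many subvarieties (that is, its set of subvarieties is countably infinite).
   Context: All varieties are varieties of semigroups, and all identities are semigroup identities; associativity is always assumed. For semigroups $S,T$, $\operatorname{var}\{S,T\}$ denotes the variety generated by $S$ and $T$, i.e. the smallest class of semigroups containing $S$ and $T$ and closed under homomorphic images, subsemigroups, and arbitrary direct products. An identity basis for a variety $\mathbf{V}$ is a set of identities satisfied by $\mathbf{V}$ from which every identity satisfied by $\mathbf{V}$ can be deduced. $J$ is the semigroup on $\{1,2,3\}$ whose Cayley table has rows $111$, $111$, $123$ (row $i$, column $j$ gives $i\cdot j$); equivalently $J=\{0,a,e\}$ with zero $0$ and $e^2=e$, $ea=a$, $ae=0$, $a^2=0$. $N_n=\langle a \mid a^n=0\rangle=\{a,a^2,\ldots,a^{n-1},0\}$ is the monogenic nilpotent semigroup of order $n$, and $N_n^1$ is the monoid obtained from $N_n$ by adjoining an identity element. *)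

(* Defs.v *)
From HB Require Import structures.
From mathcomp Require Import all_boot.
From mathcomp Require Import boolp classical_sets.

Set Implicit Arguments.
Unset Strict Implicit.
Unset Printing Implicit Defensive.

Local Open Scope classical_set_scope.
Local Open Scope group_scope.

(* A word is an element of the free semigroup over the countably infinite
   alphabet nat: a first letter followed by a possibly empty list of letters. *)
Record word := Word { whead : nat; wtail : seq nat }.

Definition word_pair (w : word) := (whead w, wtail w).
Definition pair_word (p : nat * seq nat) := Word p.1 p.2.
Lemma word_pairK : cancel word_pair pair_word. Proof. by case. Qed.
HB.instance Definition _ := Countable.copy word (can_type word_pairK).

Definition word_mul (u v : word) :=
  Word (whead u) (wtail u ++ whead v :: wtail v).
Lemma word_mulA : associative word_mul.
Proof. by move=> u v w; rewrite /word_mul /= -catA. Qed.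
HB.instance Definition _ := isSemigroup.Build word word_mulA.

Definition letter (i : nat) : word := Word i [::].

(* The unique homomorphism from words to S extending phi on letters. *)
Definition eval (S : semigroupType) (phi : nat -> S) (w : word) : S :=
  foldl (fun s i => s * phi i) (phi (whead w)) (wtail w).

(* x ^ n for n >= 1; there is no empty word, and the value at n = 0 is junk. *)
Definition spow (S : semigroupType) (x : S) (n : nat) : S := iterop n *%g x x.

Definition identity : Type := word * word.

Definition satisfies (S : semigroupType) (p : identity) : Prop :=
  forall phi : nat -> S, eval phi p.1 = eval phi p.2.

Inductive deducible (E : set identity) : word -> word -> Prop :=
| ded_axiom u v : E (u, v) -> deducible E u v
| ded_refl u : deducible E u u
| ded_sym u v : deducible E u v -> deducible E v u
| ded_trans u v w : deducible E u v -> deducible E v w -> deducible E u w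
| ded_mul u v u' v' :
    deducible E u v -> deducible E u' v' -> deducible E (u * u') (v * v')
| ded_subst (f : nat -> word) u v :
    deducible E u v -> deducible E (eval f u) (eval f v).

(* Classes of semigroups are plain predicates because classical_sets.set lives
   in a universe below that of semigroupType. *)
Definition sgclass := semigroupType -> Prop.

Definition subclass (V W : sgclass) : Prop := forall S, V S -> W S.
Definition eqclass (V W : sgclass) : Prop := forall S, V S <-> W S.

Definition class_satisfies (V : sgclass) (p : identity) : Prop :=
  forall S : semigroupType, V S -> satisfies S p.

Definition identity_basis (E : set identity) (V : sgclass) : Prop :=
  (forall p, E p -> class_satisfies V p) /\
  (forall p, class_satisfies V p -> deducible E p.1 p.2).

Section Product.
Variables (I : Type) (F : I -> semigroupType).

Definition product : Type := forall i, F i.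
HB.instance Definition _ := Choice.copy product (forall i, F i).

Definition product_mul (x y : product) : product := fun i => x i * y i.
Lemma product_mulA : associative product_mul.
Proof.
by move=> x y z; apply: functional_extensionality_dep => i; apply: mulgA.
Qed.
HB.instance Definition _ := isSemigroup.Build product product_mulA.
End Product.

(* Subsemigroups are taken up to isomorphism, as embedded semigroups.  The
   index type I may be empty, so that every variety contains the trivial
   semigroup. *)
Record is_variety (V : sgclass) : Prop := IsVariety {
  variety_image : forall (S T : semigroupType) (f : {multiplicative S -> T}),
    (forall t, exists s, f s = t) -> V S -> V T;
  variety_sub : forall (S T : semigroupType) (f : {multiplicative S -> T}),
    injective f -> V T -> V S;
  variety_product : forall (I : Type) (F : I -> semigroupType),
    (forall i, V (F i)) -> V (product F)
}.

(* The variety generated by S and T, as the intersection of all varieties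
   containing both. *)
Definition var (S T : semigroupType) : sgclass :=
  fun X => forall V : sgclass, is_variety V -> V S -> V T -> V X.

Definition subvariety (V W : sgclass) : Prop := is_variety W /\ subclass W V.

(* P, viewed up to equality of classes, is in bijection with nat. *)
Definition countably_infinite (P : sgclass -> Prop) : Prop :=
  exists W : nat -> sgclass,
    [/\ forall k, P (W k),
        forall k l, eqclass (W k) (W l) -> k = l
      & forall V, P V -> exists k, eqclass V (W k)].

(* The elements 1, 2, 3 of the Cayley table (that is, 0, a, e) are the
   ordinals 0, 1, 2. *)
Definition J : Type := 'I_3.
HB.instance Definition _ := Finite.copy J 'I_3.

Definition J_mul (i j : J) : J :=
  if i == ord_max :> 'I_3 then j else ord0 : 'I_3.

Lemma J_mul_table (i j : J) :
  (J_mul i j : 'I_3).+1 =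
  nth 0%N (nth [::] [:: [:: 1; 1; 1]; [:: 1; 1; 1]; [:: 1; 2; 3]]%N
    (i : 'I_3)) (j : 'I_3).
Proof. by case: i j => [[|[|[|i]]] i3] [[|[|[|j]]] j3]. Qed.

Lemma J_mulA : associative J_mul.
Proof. by move=> i j k; rewrite /J_mul; case: (i =P _). Qed.
HB.instance Definition _ := isSemigroup.Build J J_mulA.

(* The ordinal i stands for a ^ (i + 1); the last one, n - 1, stands for
   a ^ n = 0. *)
Definition Nilp (n : nat) : Type := 'I_n.
HB.instance Definition _ n := Finite.copy (Nilp n) 'I_n.

Lemma N_mul_subproof n (i j : 'I_n) : (minn (i + j).+1 n.-1 < n)%N.
Proof. by case: n i j => [[]//|n] i j; rewrite ltnS geq_minr. Qed.
Definition N_mul n (i j : Nilp n) : Nilp n := Ordinal (N_mul_subproof i j).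
Lemma N_mulA n : associative (@N_mul n).
Proof.
move=> i j k; apply: val_inj => /=; set m := n.-1.
rewrite addn_minr addn_minl -!minnSS -!minnA.
rewrite (minn_idPr (leqW (leq_addl i m))) (minn_idPr (leqW (leq_addr k m))).
by rewrite addnS addSn addnA.
Qed.
HB.instance Definition _ n := isSemigroup.Build (Nilp n) (@N_mulA n).

Definition adjoin1 (S : semigroupType) : Type := option S.
HB.instance Definition _ (S : semigroupType) :=
  Choice.copy (adjoin1 S) (option S).

Section AdjoinOne.
Variable S : semigroupType.
Definition adjoin1_mul (x y : adjoin1 S) : adjoin1 S :=
  match x, y with
  | Some s, Some t => Some (s * t)
  | Some _, None => x
  | None, _ => y
  end.
Lemma adjoin1_mulA : associative adjoin1_mul.
Proof. by move=> [x|] [y|] [z|] //=; rewrite mulgA. Qed.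
Lemma adjoin1_mul1 : left_id (None : adjoin1 S) adjoin1_mul.
Proof. by case. Qed.
Lemma adjoin1_mulr1 : right_id (None : adjoin1 S) adjoin1_mul.
Proof. by case. Qed.
HB.instance Definition _ :=
  isMonoid.Build (adjoin1 S) adjoin1_mulA adjoin1_mul1 adjoin1_mulr1.
End AdjoinOne.

Definition varJN1 (n : nat) : sgclass := var J (adjoin1 (Nilp n)).

Definition x_ : word := letter 0.
Definition y_ : word := letter 1.
Definition a_ : word := letter 2.

Definition basis_i (n : nat) : set identity :=
  [set (spow x_ n.+1, spow x_ n)] `|`
  [set (spow x_ m.1 * spow y_ m.2, spow y_ m.2 * spow x_ m.1)
     | m in [set m : nat * nat | (2 <= m.1)%N /\ (2 <= m.2)%N]] `|`
  [set (x_ * y_ * a_, y_ * x_ * a_)].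

Definition basis_ii (n : nat) : set identity :=
  [set (spow x_ n.+1, spow x_ n);
       (spow x_ 2 * spow y_ 2, spow y_ 2 * spow x_ 2);
       (x_ * y_ * a_, y_ * x_ * a_)].

(* Main.v *)
(** For [S] in [var {J, N_n^1}] the value of a word depends only on the
    occurrence numbers of its letters truncated at [n] and on which letter, if
    any, is a last letter occurring once: [N_n^1] sees the former and [J] the
    latter.  Conversely, [xya = yxa] permutes everything before the last letter,
    [x^(n+1) = x^n] truncates the exponents, and [x^2 y^2 = y^2 x^2] moves any
    repeated letter to the end of a word whose last letter is repeated.

    Up to renaming letters, an identity is then a multiset over the finite set of
    pairs of letter types.  Substituting [y |-> y y'] raises a nonzero
    multiplicity by one, so the identities of a subvariety form an up-set for a
    Dickson order, which has a finite basis; by Birkhoff's theorem there are only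
    countably many subvarieties.  The semigroups of square-free monomials in [k]
    variables show that there are infinitely many. *)
Require Import Defs.
From HB Require Import structures.
From mathcomp Require Import all_boot zify.
From mathcomp Require Import boolp classical_sets cardinality.

Set Implicit Arguments.
Unset Strict Implicit.
Unset Printing Implicit Defensive.

Local Open Scope group_scope.

(** * Varieties and identities *)

Lemma foldl_mulg (S : semigroupType) (X : Type) (phi : X -> S) (s : seq X) x y :
  foldl (fun t i => t * phi i) (x * y) s =
  x * foldl (fun t i => t * phi i) y s.
Proof. by elim: s y => //= z s IH y; rewrite -mulgA IH. Qed.

Lemma eval_mul (S : semigroupType) (phi : nat -> S) u v :
  eval phi (u * v) = eval phi u * eval phi v.
Proof. by rewrite /eval /= foldl_cat /= foldl_mulg. Qed.

Lemma eval_morph (S T : semigroupType) (f : {multiplicative S -> T}) phi w :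
  eval (f \o phi) w = f (eval phi w).
Proof.
rewrite /eval /=; elim: (wtail w) (phi _) => //= z s IH x.
by rewrite -gmulfM IH.
Qed.

Lemma eval_eval (S : semigroupType) (phi : nat -> S) (f : nat -> word) w :
  eval phi (eval f w) = eval (fun i => eval phi (f i)) w.
Proof.
rewrite {2 3}/eval; elim: (wtail w) (f _) => //= z s IH x.
by rewrite IH eval_mul.
Qed.

Lemma deducible_sound (E : set identity) (S : semigroupType) u v :
  (forall p, E p -> satisfies S p) -> deducible E u v -> satisfies S (u, v).
Proof.
move=> SE; elim=> {u v} [u v Euv|u|u v _ IH|u v w _ IHu _ IHv
  |u v u' v' _ IH _ IH'|f u v _ IH] phi //=.
- exact: (SE _ Euv phi).
- by rewrite [LHS]IHu; apply: IHv.
- by rewrite !eval_mul; congr (_ * _); [apply: IH|apply: IH'].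
- by rewrite !eval_eval; apply: IH.
Qed.

Lemma deducible_mono (E F : set identity) u v :
  (forall p, E p -> F p) -> deducible E u v -> deducible F u v.
Proof.
move=> EF; elim=> {u v} *; [apply: ded_axiom|apply: ded_refl|apply: ded_sym|
  apply: ded_trans|apply: ded_mul|apply: ded_subst]; eauto.
Qed.

Lemma eval_product (I : Type) (F : I -> semigroupType)
    (phi : nat -> product F) w i :
  eval phi w i = eval (fun k => phi k i) w.
Proof. by rewrite /eval; elim: (wtail w) (phi _) => //= z s IH x; rewrite IH. Qed.

Lemma models_variety (p : identity) :
  is_variety (fun S => satisfies S p).
Proof.
split=> [S T f fsurj Sp phi|S T f finj Tp phi|I F Fp phi].
- have /choice[g gK] : forall k, exists s, f s = phi k by [].
  have -> : phi = f \o g by apply/funext => k /=.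
  by rewrite !eval_morph Sp.
- by apply: finj; rewrite -!eval_morph; apply: Tp.
- by apply: functional_extensionality_dep => i; rewrite !eval_product; apply: Fp.
Qed.

Lemma variety_and (V W : sgclass) :
  is_variety V -> is_variety W -> is_variety (fun S => V S /\ W S).
Proof.
move=> vV vW; split=> [S T f fs [VS WS]|S T f fi [VT WT]|I F VWF]; split.
- exact: (variety_image vV fs).
- exact: (variety_image vW fs).
- exact: (variety_sub vV fi).
- exact: (variety_sub vW fi).
- by apply: (variety_product vV) => i; case: (VWF i).
- by apply: (variety_product vW) => i; case: (VWF i).
Qed.

Lemma var_variety (S T : semigroupType) : is_variety (var S T).
Proof.
split=> [X Y f fs VX W vW WS WT|X Y f fi VY W vW WS WT|I F VF W vW WS WT].
- by apply: (variety_image vW fs); apply: (VX W).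
- by apply: (variety_sub vW fi); apply: (VY W).
- by apply: (variety_product vW) => i; apply: (VF i W).
Qed.

Lemma var_satisfies (S T : semigroupType) p :
  class_satisfies (var S T) p <-> satisfies S p /\ satisfies T p.
Proof.
split=> [VST|[Sp Tp] X]; last by move/(_ _ (models_variety p)); apply.
by split; apply: VST => V vV.
Qed.

(** * Subsemigroups and Birkhoff's theorem *)

Section Image.
Variables (S : semigroupType) (P : set S).
Hypothesis PM : forall x y, P x -> P y -> P (x * y).

(* The vacuous dependency on [PM] lets unification recover it from the type. *)
Definition subsg : Type := let _ := PM in {x : S | P x}.
HB.instance Definition _ := gen_eqMixin subsg.
HB.instance Definition _ := gen_choiceMixin subsg.
Definition subsg_mul (x y : subsg) : subsg :=
  exist _ _ (PM (proj2_sig x) (proj2_sig y)).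
Definition subsg_val (x : subsg) : S := proj1_sig x.
Lemma subsg_inj : injective subsg_val.
Proof. by move=> [x Px] [y Py]; apply: eq_exist. Qed.
Lemma subsg_mulA : associative subsg_mul.
Proof. by move=> x y z; apply: subsg_inj; apply: mulgA. Qed.
HB.instance Definition _ := isSemigroup.Build subsg subsg_mulA.
Lemma subsg_valM : {morph subsg_val : x y / x * y}.
Proof. by []. Qed.
HB.instance Definition _ := isMultiplicative.Build subsg S subsg_val subsg_valM.
End Image.
Arguments subsg {S P} PM.
Arguments subsg_val {S P} PM.

Section FreeEval.
Variable X : Type.

(** Letters range over any type, because Birkhoff's theorem uses the elements of an arbitrary
    semigroup as letters. *)
Definition feval (S : semigroupType) (phi : X -> S) (w : X * seq X) : S :=
  foldl (fun s i => s * phi i) (phi w.1) w.2.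

Definition fmul (v w : X * seq X) := (v.1, v.2 ++ w.1 :: w.2).

Lemma feval_mul (S : semigroupType) (phi : X -> S) v w :
  feval phi (fmul v w) = feval phi v * feval phi w.
Proof. by rewrite /feval /= foldl_cat /= foldl_mulg. Qed.

Lemma feval_product (I : Type) (F : I -> semigroupType)
    (phi : X -> product F) w i :
  feval phi w i = feval (fun k => phi k i) w.
Proof. by rewrite /feval; elim: w.2 (phi _) => //= z s IH x; rewrite IH. Qed.

End FreeEval.

Lemma eval_map (X : Type) (S : semigroupType) (r : X -> nat) (phi : nat -> S) x s :
  eval phi (Word (r x) (map r s)) = feval (phi \o r) (x, s).
Proof. by rewrite /eval /feval /=; elim: s (phi _) => //=. Qed.

Lemma eq_in_feval (X : eqType) (S : semigroupType) (phi psi : X -> S) w :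
  {in w.1 :: w.2, phi =1 psi} -> feval phi w = feval psi w.
Proof.
case: w => x s /= e; rewrite /feval /= e ?mem_head //.
have : {in s, phi =1 psi} by move=> y ys; apply: e; rewrite inE ys orbT.
elim: s (psi x) {e} => //= y s IH z e.
rewrite e ?mem_head // IH // => t ts.
by apply: e; rewrite inE ts orbT.
Qed.

(* A homomorphic image of a subsemigroup of a product of members of [W], one
   factor for each pair of words over [X] that some member of [W] separates. *)
Theorem birkhoff (W : sgclass) (X : semigroupType) :
  is_variety W -> (forall p, class_satisfies W p -> satisfies X p) -> W X.
Proof.
move=> vW WX.
pose sep (q : (X * seq X) * (X * seq X)) (S : semigroupType) (phi : X -> S) :=
  W S /\ feval phi q.1 <> feval phi q.2.
pose I := {q | exists S phi, @sep q S phi}.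
pose F (i : I) : semigroupType := projT1 (cid (proj2_sig i)).
have F1 (i : I) : exists phi, sep (proj1_sig i) (F i) phi.
  by exact: projT2 (cid (proj2_sig i)).
pose phi x : product F := fun i => projT1 (cid (F1 i)) x.
have phiP i : sep (proj1_sig i) (F i) (phi^~ i) by exact: projT2 (cid (F1 i)).
have WP : W (product F) by apply: (variety_product vW) => i; case: (phiP i).
pose P (z : product F) := exists w, feval phi w = z.
have PM x y : P x -> P y -> P (x * y).
  by move=> [v <-] [w <-]; exists (fmul v w); rewrite feval_mul.
have WI : W (subsg PM).
  exact: (@variety_sub W vW _ _ (subsg_val PM) (@subsg_inj _ _ PM) WP).
(* Words with the same value under [phi] are separated by no member of [W], so they form an identity
   of [W] and hence of [X]. *)
have key v w : feval phi v = feval phi w -> feval (@id X) v = feval id w.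
  move=> evw.
  have noI : ~ exists S phi, @sep (v, w) S phi.
    move=> ex; have [_ /=] := phiP (exist _ (v, w) ex).
    by rewrite -!feval_product evw.
  (* Only finitely many letters occur: their positions in [s] rename them to numbers, and [nth]
     undoes the renaming. *)
  pose s := v.1 :: v.2 ++ w.1 :: w.2.
  pose r x := index x s.
  have rK x : x \in s -> nth v.1 s (r x) = x by exact: nth_index.
  have Wr : class_satisfies W (Word (r v.1) (map r v.2), Word (r w.1) (map r w.2)).
    move=> S WS psi; rewrite /= !eval_map -!surjective_pairing.
    by apply: contrapT => ne; apply: noI; exists S, (psi \o r).
  have := WX _ Wr (nth v.1 s); rewrite /= !eval_map -!surjective_pairing.
  rewrite (@eq_in_feval _ _ _ id v) ?(@eq_in_feval _ _ _ id w) // => x xs /=.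
    by apply: rK; rewrite inE mem_cat xs !orbT.
  by apply: rK; rewrite /s -cat_cons mem_cat xs.
pose g (z : subsg PM) : X := feval id (projT1 (cid (proj2_sig z))).
have gE (z : subsg PM) w : feval phi w = proj1_sig z -> g z = feval id w.
  by move=> ez; apply: key; rewrite ez; exact: projT2 (cid (proj2_sig z)).
have gM : {morph g : x y / x * y}.
  move=> x y; rewrite -feval_mul; apply: gE; rewrite feval_mul.
  by rewrite (projT2 (cid (proj2_sig x))) (projT2 (cid (proj2_sig y))).
pose gm := HB.pack_for {multiplicative subsg PM -> X} g
  (isMultiplicative.Build _ _ g gM).
apply: (@variety_image W vW (subsg PM) X gm _ WI).
move=> x; have Px : P (phi x) by exists (x, [::]).
by exists (exist _ _ Px); apply: (gE _ (x, [::])).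
Qed.

(** * Words *)

Definition letters (w : word) : seq nat := whead w :: wtail w.
Definition occ (x : nat) (w : word) : nat := count_mem x (letters w).
Definition wlast (w : word) : nat := last (whead w) (wtail w).

(* Whether [x] is a last letter occurring exactly once; this is what [J] detects. *)
Definition flagged (x : nat) (w : word) : bool := (wlast w == x) && (occ x w == 1)%N.

(** Splitting off the last letter suits [xya = yxa], which permutes the letters of the prefix [p]
    and never moves [s]. *)
Definition wrcons (p : seq nat) (s : nat) : word :=
  if p is x :: q then Word x (rcons q s) else letter s.

Lemma letters_wrcons p s : letters (wrcons p s) = rcons p s.
Proof. by case: p. Qed.

Lemma wlast_wrcons p s : wlast (wrcons p s) = s.
Proof. by case: p => //= x p; rewrite /wlast /= last_rcons. Qed.

Lemma letters_mul u v : letters (u * v) = letters u ++ letters v.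
Proof. by []. Qed.

Lemma letters_inj : injective letters.
Proof. by move=> [x s] [y t] [-> ->]. Qed.

Lemma wrconsE u : exists p s, u = wrcons p s.
Proof.
exists (belast (whead u) (wtail u)), (wlast u).
by apply: letters_inj; rewrite letters_wrcons -lastI.
Qed.

Lemma wrcons_cat p q s : p != [::] ->
  wrcons (p ++ q) s = Word (head 0 p) (behead p) * wrcons q s.
Proof.
move=> p0; apply: letters_inj; rewrite letters_mul !letters_wrcons /letters /=.
by case: p p0 => //= x p _; rewrite rcons_cat.
Qed.

Lemma wrcons_cons x p s : wrcons (x :: p) s = letter x * wrcons p s.
Proof. by apply: letters_inj; rewrite letters_mul !letters_wrcons. Qed.

Lemma occ_wrcons x p s : occ x (wrcons p s) = ((s == x) + count_mem x p)%N.
Proof. by rewrite /occ letters_wrcons -cats1 count_cat /= addn0 addnC. Qed.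

Lemma spowS (S : semigroupType) (x : S) m : spow x m.+2 = x * spow x m.+1.
Proof. by []. Qed.

Lemma letters_spow x m : (0 < m)%N -> letters (spow (letter x) m) = nseq m x.
Proof.
elim: m => // -[//|m] IH _.
by rewrite spowS letters_mul IH.
Qed.

Lemma eval_spow (S : semigroupType) (phi : nat -> S) w m :
  (0 < m)%N -> eval phi (spow w m) = spow (eval phi w) m.
Proof.
elim: m => // -[//|m] IH _.
by rewrite !spowS eval_mul IH.
Qed.

Lemma count_filter_neq x y (p : seq nat) :
  count_mem y [seq z <- p | z != x] = if x == y then 0%N else count_mem y p.
Proof.
rewrite count_filter; case: eqVneq => [->|xy].
  by rewrite -[RHS](count_pred0 p); apply: eq_count => z /=; case: eqP.
by apply: eq_count => z /=; case: eqP => // ->; rewrite eq_sym xy.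
Qed.

(** * Deductions from the second basis *)

Section Basis.
Variables (n : nat).
Hypothesis n2 : (2 <= n)%N.
Let D := deducible (basis_ii n).

Definition eqv (u v : word) :=
  forall x, minn n (occ x u) = minn n (occ x v) /\ flagged x u = flagged x v.

Lemma ded_mull u v w : D u v -> D (w * u) (w * v).
Proof. by apply: ded_mul; apply: ded_refl. Qed.
Lemma ded_mulr u v w : D u v -> D (u * w) (v * w).
Proof. by move=> uv; apply: ded_mul => //; apply: ded_refl. Qed.

Definition sub3 (a b c : word) (i : nat) := nth a [:: a; b; c] i.

Lemma ded_swap (u v w : word) : D (u * v * w) (v * u * w).
Proof.
pose f := sub3 u v w.
have -> : u * v * w = eval f (x_ * y_ * a_) by [].
have -> : v * u * w = eval f (y_ * x_ * a_) by [].
by apply: ded_subst; apply: ded_axiom; right.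
Qed.

Lemma ded_sq (u v : word) : D (u * u * (v * v)) (v * v * (u * u)).
Proof.
pose f := sub3 u v v.
have -> : u * u * (v * v) = eval f (spow x_ 2 * spow y_ 2) by rewrite eval_mul.
have -> : v * v * (u * u) = eval f (spow y_ 2 * spow x_ 2) by rewrite eval_mul.
by apply: ded_subst; apply: ded_axiom; left; right.
Qed.

Lemma ded_pow u : D (spow u n.+1) (spow u n).
Proof.
have -> : spow u n.+1 = eval (fun=> u) (spow x_ n.+1) by rewrite eval_spow.
have -> : spow u n = eval (fun=> u) (spow x_ n) by rewrite eval_spow //; lia.
by apply: ded_subst; apply: ded_axiom; left; left.
Qed.

Lemma ded_cons x p q s :
  D (wrcons p s) (wrcons q s) -> D (wrcons (x :: p) s) (wrcons (x :: q) s).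
Proof. by rewrite !wrcons_cons; apply: ded_mull. Qed.

(** Each exchange needs a nonempty word on its right, and the last letter [s] always supplies
    one. *)
Lemma ded_front x p q s : D (wrcons (p ++ x :: q) s) (wrcons (x :: p ++ q) s).
Proof.
elim: p => [|y p IH]; first exact: ded_refl.
apply: ded_trans (ded_cons y IH) _.
by rewrite !wrcons_cons !mulgA; apply: ded_swap.
Qed.

Lemma ded_perm p q s : perm_eq p q -> D (wrcons p s) (wrcons q s).
Proof.
elim: p q => [|x p IH] q pq.
  by rewrite perm_sym in pq; rewrite (perm_nilP pq); apply: ded_refl.
have xq : x \in q by rewrite -(perm_mem pq) mem_head.
case/splitPr: xq pq => q1 q2; rewrite perm_sym -cat1s perm_catCA perm_cons => pq.
apply: ded_trans (ded_sym (ded_front _ _ _ _)).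
by apply: ded_cons; apply: IH; rewrite perm_sym.
Qed.

(** If the prefix has [n] copies of [x], gather them in front and apply [x^(n+1) = x^n]. Otherwise
    [x] is the last letter and the prefix has exactly [n - 1] copies, which are gathered at its end
    to complete the power. *)
Lemma ded_absorb x p s : (n <= occ x (wrcons p s))%N ->
  D (wrcons p s) (wrcons (x :: p) s).
Proof.
rewrite occ_wrcons => nx.
have [le|gt] := leqP n (count_mem x p).
  pose q := nseq (count_mem x p - n) x ++ [seq y <- p | y != x].
  have pq : perm_eq p (nseq n x ++ q).
    apply/allP => y _ /=.
    apply/eqP; rewrite /q !count_cat !count_nseq count_filter_neq /=.
    by case: (eqVneq x y) => [<-|_]; rewrite ?mul1n ?mul0n ?addn0 ?subnKC.
  have e m : (0 < m)%N -> wrcons (nseq m x ++ q) s = spow (letter x) m * wrcons q s.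
    move=> m0; apply: letters_inj.
    by rewrite letters_mul letters_spow // !letters_wrcons rcons_cat.
  apply: ded_trans (ded_perm _ pq) _; apply: ded_sym.
  have /ded_perm : perm_eq (x :: p) (nseq n.+1 x ++ q) by rewrite /= perm_cons.
  move=> /(_ s) d; apply: ded_trans d _; rewrite !e; [|lia|lia].
  by apply: ded_mulr; apply: ded_pow.
have sx : s = x by move: nx gt; case: eqP => // _; lia.
subst s; have cp : count_mem x p = n.-1 by move: nx gt; rewrite eqxx; lia.
pose q := [seq y <- p | y != x].
have pq : perm_eq p (q ++ nseq n.-1 x).
  apply/allP => y _ /=; apply/eqP.
  rewrite /q !count_cat !count_nseq count_filter_neq /=.
  by case: (eqVneq x y) => [<-|_]; rewrite ?mul1n ?mul0n ?addn0 //; lia.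
apply: ded_trans (ded_perm _ pq) _; apply: ded_sym.
have /ded_perm : perm_eq (x :: p) (q ++ nseq n x).
  rewrite -[n in nseq n](prednK (_ : 0 < n)%N); last lia.
  by rewrite /= -cat1s perm_sym -[x :: nseq _ _]cat1s perm_catCA perm_cat2l perm_sym.
move=> /(_ x) d; apply: ded_trans d _.
have e m : wrcons (nseq m x) x = spow (letter x) m.+1.
  by apply: letters_inj; rewrite letters_wrcons letters_spow // -cats1 -[m.+1]addn1 nseqD.
have n0 : n = n.-1.+1 by lia.
have [q0|q0] := eqVneq q [::].
  by rewrite q0 !cat0s !e -n0; apply: ded_pow.
by rewrite !wrcons_cat // !e -n0; apply: ded_mull; apply: ded_pow.
Qed.

Lemma ded_pad e p s : (forall x, x \in e -> (n <= occ x (wrcons p s))%N) ->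
  D (wrcons p s) (wrcons (e ++ p) s).
Proof.
elim: e => [|x e IH] ne; first exact: ded_refl.
apply: ded_trans (IH _) _ => [y ye|]; first by apply: ne; rewrite inE ye orbT.
apply: ded_absorb; have := ne x (mem_head _ _).
by rewrite !occ_wrcons count_cat; lia.
Qed.

(* Padding each prefix with the letters of the other one that occur at least [n]
   times makes the prefixes permutations of each other. *)
Lemma ded_same_last p q s :
  (forall x, minn n (occ x (wrcons p s)) = minn n (occ x (wrcons q s))) ->
  D (wrcons p s) (wrcons q s).
Proof.
move=> pq; pose K x := (n <= occ x (wrcons p s))%N.
have Kq x : K x = (n <= occ x (wrcons q s))%N by move: (pq x); rewrite /K; lia.
have dp : D (wrcons p s) (wrcons ([seq x <- q | K x] ++ p) s).
  by apply: ded_pad => x; rewrite mem_filter => /andP[].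
have dq : D (wrcons q s) (wrcons ([seq x <- p | K x] ++ q) s).
  by apply: ded_pad => x; rewrite mem_filter -Kq => /andP[].
apply: ded_trans dp _; apply: ded_trans (ded_sym dq); apply: ded_perm.
apply/allP => x _ /=; apply/eqP; rewrite !count_cat !count_filter.
have cK r : count (predI (pred1 x) K) r = if K x then count_mem x r else 0%N.
  case: ifP => Kx; last rewrite -[RHS](count_pred0 r); apply: eq_count => z /=;
  by case: eqP => // ->.
(* Where [K] holds both sides count the occurrences in [p] and [q] together; elsewhere the
   truncation at [n] is exact. *)
have := pq x; have := Kq x; rewrite !cK /K !occ_wrcons.
move: (count_mem x p) (count_mem x q) (nat_of_bool _) => a b c ->.
by case: ifP; lia.
Qed.

Lemma flagged_wrcons x p s : flagged x (wrcons p s) = (s == x) && (x \notin p).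
Proof.
rewrite /flagged wlast_wrcons occ_wrcons; case: eqP => //= _.
by rewrite -has_pred1 has_count lt0n negbK.
Qed.

(** The word [p t] has at least two copies of both letters, so it can be arranged to end in
    [s s t t], and then the squares commute. *)
Lemma ded_relast p s t : s != t -> t \in p -> (1 < count_mem s p)%N ->
  exists2 q, D (wrcons p t) (wrcons q s) & perm_eq (rcons p t) (rcons q s).
Proof.
move=> st tp sp.
have p1 := perm_to_rem tp.
have c1 : count_mem s (rem t p) = count_mem s p.
  by rewrite (permP p1) /= eq_sym (negbTE st).
have s1 : s \in rem t p by rewrite -has_pred1 has_count c1; lia.
have p2 := perm_to_rem s1.
have s2 : s \in rem s (rem t p).
  by rewrite -has_pred1 has_count; move: (permP p2 (pred1 s)) => /=; rewrite eqxx c1; lia.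
have p3 := perm_to_rem s2; set r := rem s (rem s (rem t p)) in p3.
have pe : perm_eq p (r ++ [:: s; s; t]).
  rewrite (perm_trans p1) // perm_sym perm_catC /=.
  rewrite (perm_trans (y := t :: s :: s :: r)) //.
    by rewrite -[s :: s :: t :: r]/([:: s; s] ++ [:: t] ++ r) perm_catCA.
  by rewrite perm_cons perm_sym (perm_trans p2) // perm_cons.
exists (r ++ [:: t; t; s]).
  apply: ded_trans (ded_perm _ pe) _.
  have d : D (wrcons [:: s; s; t] t) (wrcons [:: t; t; s] s).
    by exact: (ded_sq (letter s) (letter t)).
  have [->//|r0] := eqVneq r [::].
  by rewrite !wrcons_cat //; apply: ded_mull.
rewrite -!cats1 (perm_trans (y := (r ++ [:: s; s; t]) ++ [:: t])) ?perm_cat2r //.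
by rewrite -!catA perm_cat2l (perm_catC [:: s; s]).
Qed.

(** If the last letters differ, neither is flagged in the other word, hence not in its own, so both
    are repeated. The second word can then be rewritten to end in [s]. *)
Lemma eqv_deducible u v : eqv u v -> D u v.
Proof.
have [p [s ->]] := wrconsE u; have [q [t ->]] := wrconsE v => e.
have [st|st] := eqVneq s t.
  by subst t; apply: ded_same_last => x; case: (e x).
have sp : s \in p.
  by have [_] := e s; rewrite !flagged_wrcons eqxx eq_sym (negbTE st) /= => /negbFE.
have tq : t \in q.
  by have [_] := e t; rewrite !flagged_wrcons eqxx (negbTE st) /= => /esym/negbFE.
(* As [2 <= n], the truncated count still shows that [s] occurs twice. *)
have sq : (1 < count_mem s q)%N.
  have [+ _] := e s; rewrite !occ_wrcons eqxx eq_sym (negbTE st).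
  by move: sp; rewrite -has_pred1 has_count; lia.
have [r d pe] := ded_relast st tq sq.
apply: ded_trans (ded_sym d); apply: ded_same_last => x.
have [-> _] := e x; congr minn.
by rewrite /occ !letters_wrcons (permP pe).
Qed.

(** * Evaluation in J and in the monoid of N_n *)

(** The letter [x] becomes [a] and the others [e]. As [e a = a] and [a e = a a = 0], the value [a]
    survives only when a single [x] stands at the end. *)
Definition J_test (x i : nat) : J := if i == x then inord 1 else ord_max.

Lemma J_eval x w :
  eval (J_test x) w =
  if flagged x w then inord 1
  else if x \in letters w then ord0 else ord_max :> 'I_3.
Proof.
case: w => h; apply: last_ind => [|s i IH].
  rewrite /eval /flagged /occ /wlast /letters inE /J_test /= addn0 eq_sym.
  by case: eqP.
have -> : eval (J_test x) (Word h (rcons s i)) = eval (J_test x) (Word h s) * J_test x i.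
  by rewrite /eval /= foldl_rcons.
have mulE (a b : J) : a * b = if a == ord_max :> 'I_3 then b else ord0 :> 'I_3 by [].
rewrite mulE IH.
have -> : flagged x (Word h (rcons s i)) = (i == x) && (x \notin h :: s).
  by rewrite -flagged_wrcons.
have -> : letters (Word h (rcons s i)) = rcons (letters (Word h s)) i by [].
rewrite mem_rcons in_cons /J_test (eq_sym x i).
have -> : flagged x (Word h s) = flagged x (Word h s) && (x \in letters (Word h s)).
  by rewrite /flagged; case: (wlast _ =P x) => //= <-; rewrite mem_last andbT.
rewrite -[x \in h :: s]/(x \in letters (Word h s)).
case: (x \in letters (Word h s)); last by rewrite andbF eqxx andbT; case: (i == x).
rewrite andbT andbF orbT.
have e1 : (inord 1 == ord_max :> 'I_3) = false by rewrite -val_eqE /= inordK.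
by case: (flagged _ _); rewrite ?e1.
Qed.

(** The letter [x] becomes the generator [a], which is the ordinal 0, and the others the adjoined
    identity: a word becomes a power of [a] counting its [x]. *)
Definition N_test (x i : nat) : adjoin1 (Nilp n) :=
  if i == x then Some (Ordinal (ltnW n2)) else None.

Lemma N_eval x w :
  omap (@nat_of_ord n) (eval (N_test x) w) =
  if occ x w is m.+1 then Some (minn m n.-1) else None.
Proof.
case: w => h; apply: last_ind => [|s i IH].
  by rewrite /eval /occ /N_test /= addn0; case: eqP => //= _; rewrite min0n.
have -> : eval (N_test x) (Word h (rcons s i)) = eval (N_test x) (Word h s) * N_test x i.
  by rewrite /eval /= foldl_rcons.
have -> : occ x (Word h (rcons s i)) = (occ x (Word h s) + (i == x))%N.
  by rewrite /occ /= -cats1 count_cat /= addn0 addnA.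
rewrite /N_test; move: IH; case: (eval _ _) => [a|]; case: (occ _ _) => [|m] //=.
  case=> am; case: eqP => _; rewrite ?addn0 ?addn1 /=; last by rewrite -am.
  by congr Some; rewrite am /=; lia.
by move=> _; case: eqP => //= _; rewrite min0n.
Qed.

Lemma JN_eqv u v : satisfies J (u, v) -> satisfies (adjoin1 (Nilp n)) (u, v) ->
  eqv u v.
Proof.
move=> Juv Nuv x; split.
  have := N_eval x u; rewrite (Nuv (N_test x)) N_eval.
  by case: (occ x u) => [|k]; case: (occ x v) => [|l] // []; lia.
have := J_eval x u; rewrite (Juv (J_test x)) J_eval.
move/(congr1 (@nat_of_ord 3)).
by case: (flagged x u) (flagged x v) => -[] //=; rewrite inordK //; case: (x \in _).
Qed.

Lemma J_ax_sq (x y : J) : x * x * (y * y) = y * y * (x * x).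
Proof. by apply: val_inj; case: x y => [[|[|[|x]]] xp] [[|[|[|y]]] yp]. Qed.

Lemma J_ax_swap (x y a : J) : x * y * a = y * x * a.
Proof. by apply: val_inj; case: x y => [[|[|[|x]]] xp] [[|[|[|y]]] yp]. Qed.

Lemma J_spow (x : J) m : spow x m.+2 = x * x.
Proof.
elim: m => // m IH; rewrite spowS IH.
by apply: val_inj; case: x {IH} => [[|[|[|x]]] xp].
Qed.

Lemma N1_mulC (x y : adjoin1 (Nilp n)) : x * y = y * x.
Proof.
by case: x y => [x|] [y|] //; congr Some; apply: val_inj; rewrite /= addnC.
Qed.

Lemma N1_spow (x : adjoin1 (Nilp n)) m :
  omap (@nat_of_ord n) (spow x m.+1) =
  if x is Some i then Some (minn (m.+1 * i.+1).-1 n.-1) else None.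
Proof.
elim: m => [|m IH].
  by case: x => // i /=; congr Some; have := ltn_ord i; lia.
rewrite spowS; move: IH; case: (spow _ _) => [a|]; case: x => //= i [] am.
by congr Some; rewrite am; lia.
Qed.

Lemma N1_pow (x : adjoin1 (Nilp n)) : spow x n.+1 = spow x n.
Proof.
have oi : injective (omap (@nat_of_ord n)).
  by move=> [a|] [b|] //= [] /val_inj ->.
have [m nm] : exists m, n = m.+1 by exists n.-1; lia.
apply: oi; rewrite N1_spow; have := N1_spow x m; rewrite -nm => ->.
by case: x => // i; congr Some; have := ltn_ord i; nia.
Qed.

Lemma satisfiesE (S : semigroupType) u v :
  satisfies S (u, v) = forall phi : nat -> S, eval phi u = eval phi v.
Proof. by []. Qed.

Lemma J_basis_i p : basis_i n p -> satisfies J p.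
Proof.
case=> [[->|[[k l] /= [k2 l2] <-]]|->]; rewrite satisfiesE => phi.
- rewrite !eval_spow //; last lia.
  by case: n n2 => [//|[//|m]] _; rewrite !J_spow.
- rewrite !eval_mul !eval_spow; [|lia|lia].
  by case: k l k2 l2 => [|[|k]] [|[|l]] // _ _; rewrite !J_spow J_ax_sq.
- by rewrite !eval_mul J_ax_swap.
Qed.

Lemma N1_basis_i p : basis_i n p -> satisfies (adjoin1 (Nilp n)) p.
Proof.
case=> [[->|[[k l] /= [k2 l2] <-]]|->]; rewrite satisfiesE => phi.
- by rewrite !eval_spow ?N1_pow //; lia.
- by rewrite !eval_mul N1_mulC.
- by rewrite !eval_mul (N1_mulC (eval _ x_)).
Qed.

Lemma basis_ii_i p : basis_ii n p -> basis_i n p.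
Proof.
case=> [[->|->]|->]; [by left; left| |by right].
by left; right; exists (2, 2)%N.
Qed.

Lemma JN1_eqv p : class_satisfies (varJN1 n) p -> eqv p.1 p.2.
Proof. by case: p => u v /var_satisfies[]; apply: JN_eqv. Qed.

Lemma basis_i_sound p : basis_i n p -> class_satisfies (varJN1 n) p.
Proof.
by move=> np; apply/var_satisfies; split; [apply: J_basis_i|apply: N1_basis_i].
Qed.

Lemma eqv_JN1 u v : eqv u v -> class_satisfies (varJN1 n) (u, v).
Proof.
move=> /eqv_deducible uv S VS; apply: deducible_sound uv => p /basis_ii_i np.
exact: basis_i_sound VS.
Qed.

Lemma basis_iiP : identity_basis (basis_ii n) (varJN1 n).
Proof.
split=> [p /basis_ii_i|p /JN1_eqv]; [exact: basis_i_sound|exact: eqv_deducible].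
Qed.

Lemma basis_iP : identity_basis (basis_i n) (varJN1 n).
Proof.
split=> [p|p /basis_iiP.2]; first exact: basis_i_sound.
exact/deducible_mono/basis_ii_i.
Qed.

End Basis.

(** * Dickson's lemma *)

Lemma increasing (g : nat -> nat) :
  (forall i, g i < g i.+1)%N -> {homo g : i j / (i < j)%N}.
Proof. by move=> gS; apply: homo_ltn => //; apply: ltn_trans. Qed.

(** Past each index, jump to a place where [f] is least on the remaining tail, and iterate. *)
Lemma monotone_subsequence (f : nat -> nat) : exists g : nat -> nat,
  {homo g : i j / (i < j)%N} /\ {homo f \o g : i j / (i < j)%N >-> (i <= j)%N}.
Proof.
have ex m : exists k, (m <= k)%N /\ forall j, (k <= j)%N -> (f k <= f j)%N.
  have exv : exists v, `[< exists2 k, (m <= k)%N & f k = v >].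
    by exists (f m); apply/asboolP; exists m.
  case: (ex_minnP exv) => v /asboolP[k mk <-] kmin; exists k; split=> // j kj.
  by apply: kmin; apply/asboolP; exists j => //; apply: leq_trans kj.
have /choice[F FP] := ex.
pose g := fix g i := if i is j.+1 then F (g j).+1 else F 0%N.
have gi : {homo g : i j / (i < j)%N}.
  by apply: increasing => i /=; case: (FP (g i).+1).
exists g; split=> // i j /gi/ltnW /=.
by case: i => [|i] ij; [apply: (FP 0%N).2|apply: (FP (g i).+1).2].
Qed.

Section Dickson.
Variables (T : countType) (H : seq (T -> nat)).

Definition leH p q := all (fun h : T -> nat => (h p <= h q)%N) H.

Lemma leH_refl p : leH p p.
Proof. by apply/allP => h _ /=. Qed.

End Dickson.

(** One monotone subsequence is extracted per function of [H]. Comparing all pairs, rather than a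
    single pair, is what survives the induction. *)
Lemma dickson (T : countType) (H : seq (T -> nat)) (f : nat -> T) :
  exists g : nat -> nat, {homo g : i j / (i < j)%N} /\
    forall i j, (i < j)%N -> leH H (f (g i)) (f (g j)).
Proof.
elim: H => [|h H [g [gi gH]]]; first by exists id; split.
have [g' [g'i g'h]] := monotone_subsequence (h \o f \o g).
exists (g \o g'); split=> [i j /g'i/gi //|i j ij /=].
by apply/andP; split; [apply: g'h|apply/gH/g'i].
Qed.

(** The finite list [B k] contains all members of [A] with code below [k]. If no [B k] generates
    [A], choose repeatedly a member above nothing in a [B k] that covers the previous choices; the
    resulting sequence contradicts Dickson's lemma. *)
Lemma upset_finite_basis (T : countType) (H : seq (T -> nat)) (A : T -> Prop) :
  (forall p q, leH H p q -> A p -> A q) ->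
  exists B : seq T, forall q, A q <-> exists2 p, p \in B & leH H p q.
Proof.
move=> up; pose B k := [seq p <- pmap unpickle (iota 0 k) | `[< A p >]].
have BP k p : p \in B k -> A p by rewrite mem_filter => /andP[/asboolP].
have BA k p : A p -> (pickle p < k)%N -> p \in B k.
  move=> Ap pk; rewrite mem_filter; apply/andP; split; first exact/asboolP.
  by rewrite mem_pmap; apply/mapP; exists (pickle p); rewrite ?pickleK // mem_iota.
have [[k kP]|none] := pselect (exists k, forall q, A q <->
    exists2 p, p \in B k & leH H p q); first by exists (B k).
have ex k : exists q, A q /\ forall p, p \in B k -> ~ leH H p q.
  apply: contrapT => noq; apply: none; exists k => q.
  split=> [Aq|[p /BP Ap pq]]; last exact: up pq Ap.
  apply: contrapT => nop; apply: noq; exists q; split=> // p pB pq.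
  by apply: nop; exists p.
have /choice[F FP] := ex.
pose f := fix f i := if i is j.+1 then F (pickle (f j)).+1 else F 0%N.
have fA i : A (f i) by case: i => [|i]; [case: (FP 0%N)|case: (FP (pickle (f i)).+1)].
have fi : {homo pickle \o f : i j / (i < j)%N}.
  apply: increasing => i /=; rewrite ltnNge; apply/negP => le.
  have [_ /(_ (f i.+1))] := FP (pickle (f i)).+1.
  by apply; [apply: BA; [apply: fA|]|apply: leH_refl].
have [g [gi gH]] := dickson H f; exfalso.
have := gi 0%N 1%N isT; have := gH 0%N 1%N isT.
(* The index [g 1] is positive, so [f (g 1)] was chosen above no member with code up to that of
   [f j], and [f (g 0)] is one of these. *)
case: (g 1%N) => // j le; rewrite ltnS => g0j.
have [_ /(_ (f (g 0%N)))] := FP (pickle (f j)).+1.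
move=> no; apply: (no _ le); apply: BA; first exact: fA.
by rewrite ltnS; move: g0j; rewrite leq_eqVlt => /orP[/eqP->//|/fi/ltnW].
Qed.

(** * Identities ordered by their letter types *)

Lemma letters_eval (f : nat -> word) u :
  letters (eval f u) = flatten [seq letters (f y) | y <- letters u].
Proof.
case: u => h; apply: last_ind => [|s i IH]; first by rewrite /= cats0.
rewrite /eval /= foldl_rcons letters_mul -/(eval f (Word h s)) IH.
by rewrite map_rcons -cats1 flatten_cat /= cats0 catA.
Qed.

Lemma wlast_mul u v : wlast (u * v) = wlast v.
Proof. by rewrite /wlast /= last_cat. Qed.

Lemma wlast_eval (f : nat -> word) u : wlast (eval f u) = wlast (f (wlast u)).
Proof.
case: u => h; apply: last_ind => // s i IH.
by rewrite /eval /= foldl_rcons wlast_mul {3}/wlast /= last_rcons.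
Qed.

Lemma wlast_in u : wlast u \in letters u.
Proof. exact: mem_last. Qed.

Lemma flagged_occ x u : x \notin letters u -> occ x u = 0%N /\ flagged x u = false.
Proof.
move=> /count_memPn xu; split=> //.
by rewrite /flagged /occ xu andbF.
Qed.

Section Transfer.
Variable n : nat.

(** Each letter of [Q] lies once in exactly one fiber of [g], and [f] replaces a letter of [u] by
    the product of its fiber, so [x] in [Q] occurs in the result as often as [g x] in [u]. *)
Lemma eqv_subst (Q : seq nat) (g : nat -> nat) (f : nat -> word) u v :
  uniq Q -> {subset letters v <= Q} ->
  {in letters u, forall y, letters (f y) = [seq x <- Q | g x == y]} ->
  {in Q, forall x, minn n (occ (g x) u) = minn n (occ x v)
                /\ flagged (g x) u = flagged x v} ->
  eqv n (eval f u) v.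
Proof.
move=> uQ vQ fQ gQ x.
have fib y : y \in letters u -> count_mem x (letters (f y)) = (x \in Q) && (g x == y).
  by move=> yu; rewrite fQ // count_uniq_mem ?filter_uniq // mem_filter andbC.
have occE : occ x (eval f u) = if x \in Q then occ (g x) u else 0%N.
  rewrite {1}/occ letters_eval count_flatten -map_comp.
  have /eq_in_map -> : {in letters u, count_mem x \o (letters \o f) =1
      fun y => nat_of_bool ((x \in Q) && (g x == y))} by move=> y /fib.
  rewrite sumn_count; case: (x \in Q); last first.
    by rewrite -[RHS](count_pred0 (letters u)); apply: eq_count.
  by apply: eq_count => y /=; rewrite eq_sym.
have [xQ|xQ] := boolP (x \in Q); last first.
  have xv : x \notin letters v by apply: contra xQ => /vQ.
  have [-> ->] := flagged_occ xv.
  by rewrite /flagged occE (negbTE xQ) andbF.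
rewrite xQ in occE; have [gocc gfl] := gQ x xQ.
split; first by rewrite occE.
rewrite -gfl /flagged occE wlast_eval; case: eqP => [lx|lx].
  have : x \in letters (f (wlast u)) by rewrite -lx wlast_in.
  by rewrite fQ ?wlast_in // mem_filter => /andP[/eqP -> _]; rewrite eqxx.
(* The last letter of [f (g x)] has the same image as [x], so it is flagged in [v] too; a word has
   at most one flagged letter. *)
apply/esym/negP => fl; apply: lx; have /andP[/eqP ul _] := fl.
have := wlast_in (f (wlast u)); rewrite {2}ul fQ -?ul ?wlast_in // mem_filter ul.
move=> /andP[/eqP gx' x'Q].
have : flagged x v by rewrite -gfl.
have : flagged (wlast (f (g x))) v by rewrite -(gQ _ x'Q).2 gx'.
by move=> /andP[/eqP <- _] /andP[/eqP <- _].
Qed.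

Let ltype : finType := ('I_n.+1 * bool)%type.
(** Truncation leaves finitely many types and keeps [inord] within its range. *)
Definition letter_type (x : nat) (u : word) : ltype :=
  (inord (minn n (occ x u)), flagged x u).
Definition ident_type (x : nat) (p : identity) : ltype * ltype :=
  (letter_type x p.1, letter_type x p.2).

Lemma letter_type_eqP x y u v : letter_type x u = letter_type y v ->
  minn n (occ x u) = minn n (occ y v) /\ flagged x u = flagged y v.
Proof.
by move=> [/(congr1 val)]; rewrite /= !inordK ?ltnS ?geq_minl.
Qed.

Definition ident_letters (p : identity) : seq nat := undup (letters p.1 ++ letters p.2).
Definition type_fiber (t : ltype * ltype) (p : identity) :=
  [seq x <- ident_letters p | ident_type x p == t].

(* Monotonicity of the second family says that the types occurring in the larger
   identity already occur in the smaller one. *)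
Definition type_counts : seq (identity -> nat) :=
  [seq (fun p => size (type_fiber t p)) | t <- enum {: ltype * ltype}] ++
  [seq (fun p => nat_of_bool (type_fiber t p == [::])) | t <- enum {: ltype * ltype}].

Definition type_le := leH type_counts.

Lemma type_leP p q : type_le p q -> forall t,
  (size (type_fiber t p) <= size (type_fiber t q))%N /\
  (type_fiber t p = [::] -> type_fiber t q = [::]).
Proof.
rewrite /type_le /leH all_cat => /andP[/allP le1 /allP le2] t; split.
  by apply: (le1 (fun p => size (type_fiber t p))); apply: map_f; rewrite mem_enum.
move=> p0; have := le2 (fun p => nat_of_bool (type_fiber t p == [::])).
by rewrite map_f ?mem_enum // p0 eqxx => /(_ isT); case: eqP.
Qed.

(* [g] maps the letters of [q] onto those of [p] preserving types, and [f]
   replaces a letter of [p] by the product of its fiber. *)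
Lemma type_le_subst p q : type_le p q ->
  exists f, eqv n (eval f p.1) q.1 /\ eqv n (eval f p.2) q.2.
Proof.
move/type_leP => pq.
(* The letters of a fiber of [q] go in order to those of the fiber of [p], and the surplus ones all
   go to the last. *)
pose g x := let L := type_fiber (ident_type x q) p in
  nth 0%N L (minn (index x (type_fiber (ident_type x q) q)) (size L).-1).
have gfib x : x \in ident_letters q -> g x \in type_fiber (ident_type x q) p.
  move=> xq; apply: mem_nth.
  rewrite (leq_ltn_trans (geq_minr _ _)) // prednK // lt0n size_eq0.
  apply/eqP => /(pq _).2/eqP; rewrite -[_ == _]negbK -has_filter.
  by move=> /hasP; apply; exists x.
have gtyp x : x \in ident_letters q -> ident_type (g x) p = ident_type x q.
  by move=> /gfib; rewrite mem_filter => /andP[/eqP].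
have gsurj y : y \in ident_letters p -> exists2 x, x \in ident_letters q & g x = y.
  move=> yp; set t := ident_type y p.
  have yt : y \in type_fiber t p by rewrite mem_filter eqxx.
  have [le _] := pq t.
  have iy : (index y (type_fiber t p) < size (type_fiber t p))%N by rewrite index_mem.
  pose x := nth 0%N (type_fiber t q) (index y (type_fiber t p)).
  have xt : x \in type_fiber t q by apply/mem_nth/(leq_trans iy).
  have := xt; rewrite mem_filter => /andP[/eqP xq ?]; exists x => //.
  rewrite /g xq index_uniq ?filter_uniq ?undup_uniq //; last exact: leq_trans le.
  by rewrite (minn_idPl _) ?nth_index //; lia.
(* The default 0 is never reached on letters of [p], whose fibers are nonempty by [gsurj]. *)
pose f y := let s := [seq x <- ident_letters q | g x == y] in
  Word (head 0%N s) (behead s).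
have fE y : y \in ident_letters p ->
  letters (f y) = [seq x <- ident_letters q | g x == y].
  move=> /gsurj[x xq gx]; rewrite /f /letters /=.
  have : x \in [seq x <- ident_letters q | g x == y] by rewrite mem_filter gx eqxx.
  by case: [seq _ <- _ | _].
exists f; split; apply: (eqv_subst (Q := ident_letters q) (g := g));
  rewrite ?undup_uniq //.
- by move=> x xq; rewrite mem_undup mem_cat xq.
- by move=> y yp; apply: fE; rewrite mem_undup mem_cat yp.
- by move=> x /gtyp/(congr1 fst)/letter_type_eqP.
- by move=> x xq; rewrite mem_undup mem_cat xq orbT.
- by move=> y yp; apply: fE; rewrite mem_undup mem_cat yp orbT.
- by move=> x /gtyp/(congr1 snd)/letter_type_eqP.
Qed.

End Transfer.

(** * Infinitely many subvarieties *)

Section SquareFree.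
Variable k : nat.
Local Notation zero := (finset.set0 : {set 'I_k}).

(* Nonempty sets are square-free monomials, and the empty set is the zero. *)
Definition sqfree : Type := {set 'I_k}.
HB.instance Definition _ := Finite.copy sqfree {set 'I_k}.

Definition sqfree_mul (A B : {set 'I_k}) : {set 'I_k} :=
  if [&& A != zero, B != zero & A :&: B == zero] then A :|: B else zero.

Lemma sqfree_mulA : associative (sqfree_mul : sqfree -> sqfree -> sqfree).
Proof.
move=> A B C; rewrite /sqfree_mul.
have [->|A0] := eqVneq (A : {set 'I_k}) zero; first by rewrite /= eqxx.
have [->|B0] := eqVneq (B : {set 'I_k}) zero; first by rewrite /= !eqxx.
have [->|C0] := eqVneq (C : {set 'I_k}) zero; first by rewrite /= !eqxx ?andbF.
rewrite /=; have [AB|AB] := eqVneq (A :&: B) zero; last first.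
  rewrite eqxx /=; case: (B :&: C == zero); rewrite ?eqxx ?andbF //=.
  by rewrite finset.setIUr !finset.setU_eq0 (negbTE AB) andbF.
have [BC|BC] := eqVneq (B :&: C) zero; last first.
  by rewrite eqxx /= finset.setIUl !finset.setU_eq0 (negbTE BC) !andbF.
rewrite !finset.setU_eq0 finset.setIUr finset.setIUl !finset.setU_eq0 AB BC.
by rewrite eqxx (negbTE A0) (negbTE B0) andbT finset.setUA.
Qed.
HB.instance Definition _ := isSemigroup.Build sqfree sqfree_mulA.

Lemma sqfree_mulE (A B : sqfree) : A * B = sqfree_mul A B :> {set 'I_k}.
Proof. by []. Qed.

Lemma sqfree_mulC (A B : sqfree) : A * B = B * A.
Proof.
by rewrite !sqfree_mulE /sqfree_mul finset.setIC finset.setUC andbCA.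
Qed.

Lemma sqfree_sq (A : sqfree) : A * A = zero :> {set 'I_k}.
Proof.
by rewrite sqfree_mulE /sqfree_mul finset.setIid; case: eqVneq.
Qed.

Lemma sqfree_spow (A : sqfree) m : spow A m.+2 = zero :> {set 'I_k}.
Proof.
elim: m => [|m IH]; first exact: sqfree_sq.
by rewrite spowS sqfree_mulE IH /sqfree_mul eqxx andbF.
Qed.

Lemma sqfree_basis_ii n p : (2 <= n)%N -> basis_ii n p -> satisfies sqfree p.
Proof.
move=> n2 [[->|->]|->]; rewrite satisfiesE => phi.
- rewrite !eval_spow //; last lia.
  by case: n n2 => [//|[//|m]] _; rewrite !sqfree_spow.
- by rewrite !eval_mul sqfree_mulC.
- by rewrite !eval_mul (sqfree_mulC (eval _ x_)).
Qed.

(** Commutativity and vanishing squares imply the second basis, and Birkhoff's theorem turns this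
    into membership. *)
Lemma sqfree_JN1 n : (2 <= n)%N -> varJN1 n sqfree.
Proof.
move=> n2; apply: birkhoff => [|p /(basis_iiP n2).2]; first exact: var_variety.
by case: p => u v /=; apply: deducible_sound => p; apply: sqfree_basis_ii.
Qed.

(** The factors of a nonzero product are disjoint and nonempty, so each one contributes a variable
    of its own. *)
Lemma sqfree_size (phi : nat -> sqfree) w :
  eval phi w != zero -> (size (wtail w) < #|eval phi w : {set 'I_k}|)%N.
Proof.
case: w => h; apply: last_ind => [|s i IH]; first by rewrite card_gt0.
rewrite /eval /= foldl_rcons size_rcons -/(eval phi (Word h s)).
rewrite sqfree_mulE /sqfree_mul; case: ifP; last by rewrite eqxx.
move=> /and3P[e0 i0 /eqP d] _.
rewrite cardsU d cards0 subn0; have := IH e0.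
by rewrite -card_gt0 in i0; move: i0 => /=; lia.
Qed.

End SquareFree.

(** In square-free monomials the right side vanishes because of the repeated letter, so the identity
    says that all products of [k + 1] factors are zero. *)
Definition linear (k : nat) : identity :=
  (Word 0 (iota 1 k), Word 0 (0%N :: iota 1 k)).

Lemma sqfree_linear k l : (k < l)%N -> satisfies (sqfree k.+1) (linear l).
Proof.
move=> kl phi; have z w : (l <= size (wtail w))%N ->
  eval phi w = finset.set0 :> {set 'I_k.+1}.
  move=> wl; apply/eqP/negPn/negP => /sqfree_size lt.
  have := leq_trans lt (max_card _); rewrite card_ord; lia.
by rewrite z /= ?size_iota // z //= size_iota.
Qed.

Lemma sqfree_not_linear k : ~ satisfies (sqfree k.+1) (linear k).
Proof.
pose phi (i : nat) : sqfree k.+1 := [set (inord i : 'I_k.+1)]%SET.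
have e m : (m <= k)%N ->
  eval phi (Word 0 (iota 1 m)) = [set i : 'I_k.+1 | (i <= m)%N]%SET :> {set 'I_k.+1}.
  elim: m => [_|m IH mk].
    apply/setP => i; rewrite /eval /= !inE leqn0 -val_eqE /= inordK //.
  have -> : iota 1 m.+1 = rcons (iota 1 m) m.+1 by rewrite -cats1 -[X in iota 1 X]addn1 iotaD.
  rewrite /eval /= foldl_rcons -/(eval phi (Word 0 (iota 1 m))).
  rewrite sqfree_mulE /sqfree_mul IH ?(ltnW mk) //.
  have iK : (inord m.+1 : 'I_k.+1) = m.+1 :> nat by rewrite inordK.
  case: ifP => [_|/negbT/negP[]].
    by apply/setP => i; rewrite !inE -val_eqE /= iK; lia.
  apply/and3P; split.
  - by apply/set0Pn; exists ord0; rewrite inE.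
  - by apply/set0Pn; exists (inord m.+1); rewrite inE.
  - by apply/eqP/setP => i; rewrite !inE -val_eqE /= iK; lia.
move/(_ phi) => /=; rewrite e // => /setP/(_ ord0); rewrite inE /=.
have -> : eval phi (Word 0 (0%N :: iota 1 k)) = finset.set0 :> {set 'I_k.+1}.
  apply/eqP/negPn/negP => /sqfree_size /=; rewrite size_iota.
  by rewrite ltnNge => /negP[]; rewrite (leq_trans (max_card _)) // card_ord.
by rewrite inE.
Qed.

(** * Enumeration of the subvarieties *)

Section Count.
Variables (n : nat) (n2 : (2 <= n)%N).

(** Modulo the identities of [varJN1 n], [q] is a substitution instance of [p]. *)
Lemma type_le_satisfies (W : sgclass) p q : subclass W (varJN1 n) ->
  type_le n p q -> class_satisfies W p -> class_satisfies W q.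
Proof.
move=> WJ /type_le_subst[f [/(eqv_JN1 n2) e1 /(eqv_JN1 n2) e2]] Wp S WS phi.
rewrite -[LHS](e1 S (WJ S WS) phi) -[RHS](e2 S (WJ S WS) phi) /= !eval_eval.
exact: Wp.
Qed.

Lemma eq_theory (V W : sgclass) : is_variety V -> is_variety W ->
  (forall p, class_satisfies V p <-> class_satisfies W p) -> eqclass V W.
Proof.
move=> vV vW VW S; split=> HS; apply: birkhoff => // p.
  by move=> /VW; apply.
by move=> /VW; apply.
Qed.

(** By Birkhoff's theorem [V] is determined by its identities, and these by a finite list generating
    them as an up-set, so a number can encode [V]. *)
Definition coded (k : nat) (V : sgclass) : Prop :=
  subvariety (varJN1 n) V /\
  exists B : seq identity, pickle B = k /\
    forall q, class_satisfies V q <-> exists2 p, p \in B & type_le n p q.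

Lemma coded_ex V : subvariety (varJN1 n) V -> exists k, coded k V.
Proof.
move=> VP; have VJ := VP.2.
have [B BP] := @upset_finite_basis _ (type_counts n) (class_satisfies V)
  (fun p q => @type_le_satisfies V p q VJ).
by exists (pickle B); split=> //; exists B.
Qed.

Lemma coded_eq k V W : coded k V -> coded k W -> eqclass V W.
Proof.
move=> [[vV _] [B [<- BV]]] [[vW _] [C [/(pcan_inj pickleK) -> CW]]].
by apply: eq_theory => // p; rewrite BV CW.
Qed.

Lemma eqclass_coded k V W : subvariety (varJN1 n) W ->
  eqclass V W -> coded k V -> coded k W.
Proof.
move=> WP VW [_ [B [Bk BV]]]; split=> //; exists B; split=> // q.
by rewrite -BV; split=> h S /VW; apply: h.
Qed.

Lemma eqclass_sym V W : eqclass V W -> eqclass W V.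
Proof. by move=> VW S; rewrite VW. Qed.

(* Each subvariety has several codes, so the smallest one is singled out. *)
Definition least_code (k : nat) : Prop :=
  exists V, coded k V /\ forall j, coded j V -> (k <= j)%N.

Lemma least_code_ex V : subvariety (varJN1 n) V ->
  exists k, least_code k /\ coded k V.
Proof.
move=> VP; have ex : exists k, `[< coded k V >].
  by have [k kV] := coded_ex VP; exists k; apply/asboolP.
case: (ex_minnP ex) => k /asboolP kV kmin; exists k; split=> //; exists V.
by split=> // j /asboolP; apply: kmin.
Qed.

Lemma least_code_uniq k l V : least_code k -> least_code l ->
  coded k V -> coded l V -> k = l.
Proof.
have half i j : least_code i -> coded i V -> coded j V -> (i <= j)%N.
  move=> [W [iW iWmin]] iV jV; apply: iWmin.
  by apply: eqclass_coded (coded_eq iV iW) jV; case: iW.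
by move=> kl ll kV lV; apply/eqP; rewrite eqn_leq !half.
Qed.

Definition linear_subvariety (k : nat) : sgclass :=
  fun S => varJN1 n S /\ satisfies S (linear k).

Lemma linear_subvarietyP k : subvariety (varJN1 n) (linear_subvariety k).
Proof.
split; last by move=> S [].
by apply: variety_and; [apply: var_variety|apply: models_variety].
Qed.

(** For [i < j] the semigroup [sqfree i.+1] satisfies [linear j] but not [linear i]. *)
Lemma linear_subvariety_inj k l :
  eqclass (linear_subvariety k) (linear_subvariety l) -> k = l.
Proof.
have half i j : eqclass (linear_subvariety i) (linear_subvariety j) -> (j <= i)%N.
  move=> e; rewrite leqNgt; apply/negP => ij.
  have [|_] := (e (sqfree i.+1)).2; last exact: sqfree_not_linear.
  by split; [apply: sqfree_JN1|apply: sqfree_linear].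
by move=> e; apply/eqP; rewrite eqn_leq !half //; apply: eqclass_sym.
Qed.

(** Least codes number the subvarieties injectively. The linear subvarieties make the set of least
    codes infinite, so it is enumerated by a bijection [e] from the naturals. *)
Lemma subvarieties_countably_infinite : countably_infinite (subvariety (varJN1 n)).
Proof.
have /choice[c cP] := fun k => least_code_ex (linear_subvarietyP k).
have c_inj : injective c.
  move=> k l ckl; apply: linear_subvariety_inj.
  by have [_ ck] := cP k; have [_] := cP l; rewrite -ckl; apply: coded_eq.
have inf : infinite_set (least_code : set nat).
  move/(@finite_preimage _ _ _ c) => fin; apply: infinite_nat.
  have <- : (c @^-1` least_code)%classic = [set: nat]%classic.
    by apply/seteqP; split=> // k _; case: (cP k).
  by apply: fin => k l _ _; apply: c_inj.
have /card_esym/card_set_bijP[e [e_fun e_inj e_surj]] := eq_card_nat (countableP _) inf.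
have eP k : least_code (e k) by exact: e_fun.
have eI : injective e by move=> k l; apply: e_inj; rewrite inE.
(* All varieties coded by [e k] coincide, so intersecting them names this one without choosing. *)
pose W k : sgclass := fun S => forall V, coded (e k) V -> V S.
have WE k V : coded (e k) V -> eqclass V (W k).
  move=> kV S; split=> [VS V' kV'|]; last by apply.
  by apply/(coded_eq kV kV').
have WP k : subvariety (varJN1 n) (W k).
  have [V [kV _]] := eP k; have VW := WE k V kV; have [[vV VJ] _] := kV.
  split; last by move=> S /VW/VJ.
  split=> [S T f fs /VW VS|S T f fi /VW VT|I F WF]; apply/VW.
  - exact: (variety_image vV fs).
  - exact: (variety_sub vV fi).
  - by apply: (variety_product vV) => i; apply/VW.
exists W; split=> // [k l kl|V VP].
  have [V [kV _]] := eP k; have [V' [lV' _]] := eP l.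
  apply: eI; apply: (@least_code_uniq _ _ V) => //.
  apply: eqclass_coded (lV') => [|S]; first by case: kV.
  by rewrite (WE l V') // -kl (WE k V).
have [k [kl kV]] := least_code_ex VP.
by have [i _ ik] := e_surj k kl; exists i; apply: WE; rewrite ik.
Qed.

End Count.

Theorem propositionC7 (n : nat) (hn : (2 <= n)%N) :
  [/\ identity_basis (basis_i n) (varJN1 n),
      identity_basis (basis_ii n) (varJN1 n)
    & countably_infinite (subvariety (varJN1 n))].
Proof.
split; [exact: basis_iP|exact: basis_iiP|exact: subvarieties_countably_infinite].
Qed.
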